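(* Let $F_1$ be the $3$-graph on vertex set $\{a,b,c,d,e,f,g\}$ with edge set $\{abe, ace, bce, abf, adf, bdf, cdg\}$. Then $\gamma^+(F_1) = \frac{2}{5}$.
   Context: For a $3$-graph $H$, the minimum positive co-degree $\delta_2^+(H)$ is the largest $k$ such that every pair of vertices contained in some edge of $H$ is contained in at least $k$ edges (it is $0$ for the edgeless graph). For a $3$-graph $F$, $\mathrm{co^+ex}(n,F)$ is the maximum of $\delta_2^+(H)$ over $n$-vertex $3$-graphs $H$ not containing $F$ as a (not necessarily induced) subhypergraph, and $\gamma^+(F)=\lim_{n\to\infty}\mathrm{co^+ex}(n,F)/n$ (the limit exists). *)

(* Defs.v *)
From mathcomp Require Import all_boot all_order all_algebra.
From mathcomp Require Import all_classical all_reals all_analysis.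
Import Order.TTheory GRing.Theory Num.Theory.
Import numFieldNormedType.Exports.

Set Implicit Arguments.
Unset Strict Implicit.
Unset Printing Implicit Defensive.

Definition is_3graph (T : finType) (H : {set {set T}}) : bool :=
  [forall e in H, #|e| == 3].

Definition codeg (T : finType) (H : {set {set T}}) (p : {set T}) : nat :=
  #|[set e in H | p \subset e]|.

(* Every pair of vertices lying in some edge lies in at least [k] edges. *)
Definition pos_codeg_ge (T : finType) (H : {set {set T}}) (k : nat) : bool :=
  [forall p : {set T}, (#|p| == 2) && [exists e in H, p \subset e]
                       ==> (k <= codeg H p)].

(* The bound [k <= #|T|] only serves to make the maximum finite: a pair of
   vertices of a 3-graph lies in at most [#|T| - 2] edges. *)
Definition min_pos_codeg (T : finType) (H : {set {set T}}) : nat :=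
  if H == finset.set0 then 0
  else \max_(k < #|T|.+1 | pos_codeg_ge H k) k.

(* [F] is a (not necessarily induced) subhypergraph of [H]. *)
Definition contains (U T : finType) (F : {set {set U}}) (H : {set {set T}}) :
    bool :=
  [exists f : {ffun U -> T},
    injectiveb f && [forall e in F, [set f x | x in e]%SET \in H]].

Definition coex_pos (n : nat) (U : finType) (F : {set {set U}}) : nat :=
  \max_(H : {set {set 'I_n}} | is_3graph H && ~~ contains F H)
     min_pos_codeg H.

Definition coex_pos_ratio (R : realType) (U : finType) (F : {set {set U}})
    (n : nat) : R := ((coex_pos n F)%:R / n%:R)%R.

(* [limn] is a total operator, so it has its usual meaning only when
   [coex_pos_ratio R F] converges. *)
Definition gamma_pos (R : realType) (U : finType) (F : {set {set U}}) : R :=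
  limn (coex_pos_ratio R F).

(* The vertices a, b, c, d, e, f, g are 0, ..., 6. *)
Definition F1 : {set {set 'I_7}} :=
  let a : 'I_7 := inord 0 in let b : 'I_7 := inord 1 in
  let c : 'I_7 := inord 2 in let d : 'I_7 := inord 3 in
  let e : 'I_7 := inord 4 in let f : 'I_7 := inord 5 in
  let g : 'I_7 := inord 6 in
  [set [set a; b; e]; [set a; c; e]; [set b; c; e];
       [set a; b; f]; [set a; d; f]; [set b; d; f];
       [set c; d; g]]%SET.

(* Main.v *)
(* Lower bound: in the balanced blow-up of the triangular bipyramid (equator
   0, 1, 2 and poles 3, 4) every pair of classes lying in a face lies in two
   faces, so the positive codegree is about 2n/5.  The only triangle contained
   in the link of a vertex is the equator, seen from a pole; hence in a copy of
   F1 the vertices c and d get the same colour, and cd is not covered.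

   Upper bound: let k be the positive codegree and suppose k >= (2/5 + eps) n.
   Call a triple abc rich if it has at least three apexes e, i.e. abe, ace and
   bce are edges.  When abc and abd are rich and cd is covered, F1 embeds
   greedily.  Only O(n^5) of the 6-tuples of vertices contain a K4^- with a base
   that is not rich, so these tuples may be ignored and F1-freeness behaves as
   freeness from all homomorphic images of F1.  Since 3k > n, there are order
   n^4 copies of K4^-.  If abc is the base of a K4^- with apex e, give the pairs
   inside abc weight 2 and the pairs at e weight 3: then a vertex v contributes
   at most 2/5 of the total weight, unless v extends the copy to one particular
   5-vertex configuration on which all pairs are covered.  Since the average
   contribution exceeds 2/5, there are order n^5 such configurations.  On each of them a second
   weighting of the ten pairs allows every further vertex w at most 2/5 of the
   total, which contradicts k >= (2/5 + eps) n. *)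
Require Import Defs.
From mathcomp Require Import all_boot all_order all_algebra all_fingroup.
From mathcomp Require Import zify ring lra.
From mathcomp Require Import all_classical all_reals all_analysis.
Import Order.TTheory GRing.Theory Num.Theory.
Import numFieldNormedType.Exports.

Set Implicit Arguments.
Unset Strict Implicit.
Unset Printing Implicit Defensive.

(** * Links of vertices in a 3-graph without homomorphic images of F1 *)

Definition symmetric3 (I : Type) (g : I -> I -> I -> bool) : Prop :=
  (forall x y z, g x y z = g y x z) /\ (forall x y z, g x y z = g x z y).

(* [e] and [f] may coincide, as may [c] and [f], or [d] and [e]. *)
Definition F1_hom_free (I : Type) (g : I -> I -> I -> bool) : Prop :=
  forall a b c d e f s, g a b e -> g a c e -> g b c e ->
    g a b f -> g a d f -> g b d f -> g c d s -> False.

Definition K4minus (I : Type) (g : I -> I -> I -> bool) (a b c e : I) : bool :=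
  [&& g a b e, g a c e & g b c e].

(** The 5-vertex configuration of the upper bound. Its six edges cover all ten pairs, and exchanging
    a with e and c with v while fixing b is an automorphism. *)
Definition K4minus_ext (I : Type) (g : I -> I -> I -> bool) (a b c e v : I) :
    bool :=
  [&& K4minus g a b c e, g v a e, g v a b & g v b c].

Ltac edge gC gA := first
  [ assumption
  | rewrite gC; assumption
  | rewrite gA; assumption
  | rewrite gC gA; assumption
  | rewrite gA gC; assumption
  | rewrite gC gA gC; assumption ].

Lemma K4minus_link_forbidden (I : Type) (g : I -> I -> I -> bool)
    (a b c e v : I) :
  symmetric3 g -> F1_hom_free g -> K4minus g a b c e ->
  ~~ [|| [&& g v a e, g v a b & g v a c],
         [&& g v a e, g v b e & g v c e],
         [&& g v a e, g v b e & g v a c],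
         [&& g v a e, g v b e & g v b c] |
         [&& g v a e, g v b e & g v a b]].
Proof.
case=> gC gA free /and3P[abe ace bce]; rewrite !negb_or.
apply/and5P; split; apply/negP=> /and3P[? ? ?].
(* The arguments of [free] are the images of the seven vertices of F1. The first four patterns use
   one vertex for both apexes e and f; the last one sends d and e to the apex of the given copy. *)
- by apply: (free v e b c a a e); edge gC gA.
- by apply: (free a b c v e e e); edge gC gA.
- by apply: (free a b c v e e a); edge gC gA.
- by apply: (free a b c v e e b); edge gC gA.
- by apply: (free a b c e e v a); edge gC gA.
Qed.

(** The total weight is 15, so 6 is the fraction 2/5. Up to permuting a, b, c, the only allowed link
    of larger weight is {ae, ab, bc}, of weight 7; the six correction terms are its six
    placements. *)
Lemma K4minus_link (I : Type) (g : I -> I -> I -> bool) (a b c e v : I) :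
  symmetric3 g -> F1_hom_free g -> K4minus g a b c e ->
  2 * (g v a b + g v a c + g v b c) + 3 * (g v a e + g v b e + g v c e)
  <= 6 + (K4minus_ext g a b c e v + K4minus_ext g b a c e v
          + K4minus_ext g a c b e v + K4minus_ext g c a b e v
          + K4minus_ext g b c a e v + K4minus_ext g c b a e v).
Proof.
move=> gS free abce; have [gC gA] := gS.
have [abe ace bce] := and3P abce.
have K x y z : g x y e -> g x z e -> g y z e -> K4minus g x y z e.
  by move=> xy xz yz; rewrite /K4minus xy xz.
have bcae : K4minus g b c a e by apply: K; edge gC gA.
have cabe : K4minus g c a b e by apply: K; edge gC gA.
have bace : K4minus g b a c e by apply: K; edge gC gA.
have acbe : K4minus g a c b e by apply: K; edge gC gA.
have cbae : K4minus g c b a e by apply: K; edge gC gA.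
move: (K4minus_link_forbidden v gS free abce).
move: (K4minus_link_forbidden v gS free bcae).
move: (K4minus_link_forbidden v gS free cabe).
rewrite /K4minus_ext abce bcae cabe bace acbe cbae /=.
rewrite (gA v b a) (gA v c a) (gA v c b).
by case: (g v a b); case: (g v a c); case: (g v b c);
   case: (g v a e); case: (g v b e); case: (g v c e).
Qed.

(** The arguments tell which pairs lie in the link of w. Of two patterns exchanged by the
    automorphism of [K4minus_ext], only one is listed. *)
Definition forbidden_links (ab ac ae av bc be bv ce cv ev : bool) : bool :=
  [|| [&& ab, ac & ae], [&& ac, ae & av], [&& ac, ae & be],
      [&& ab, av & be], [&& ae, av & bv], [&& ab, be & bv],
      [&& bc, be & bv], [&& av, be & ce], [&& ae, bv & ce],
      [&& bc, bv & ce], [&& ae, bc & cv], [&& ab, av & ev],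
      [&& av, bv & ev], [&& bc, cv & ev], [&& ce, cv & ev],
      [&& av, bc, be & ev] | [&& ae, bc, bv & ev]].

Lemma K4minus_ext_forbidden (I : Type) (g : I -> I -> I -> bool)
    (a b c e v w : I) :
  symmetric3 g -> F1_hom_free g -> K4minus_ext g a b c e v ->
  ~~ forbidden_links (g w a b) (g w a c) (g w a e) (g w a v) (g w b c)
       (g w b e) (g w b v) (g w c e) (g w c v) (g w e v).
Proof.
case=> gC gA free /and4P[/and3P[abe ace bce] ave abv bcv].
rewrite /forbidden_links !negb_or.
repeat (apply/andP; split); apply/negP;
  first [case/and4P=> ? ? ? ? | case/and3P=> ? ? ?].
- by apply: (free e w b c a a e); edge gC gA.
- by apply: (free e w c v a a b); edge gC gA.
- by apply: (free a b c w e e a); edge gC gA.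
- by apply: (free b v e w a a b); edge gC gA.
- by apply: (free e v b w a a v); edge gC gA.
- by apply: (free a w e v b b a); edge gC gA.
- by apply: (free c w e v b b a); edge gC gA.
- by apply: (free b c a w e e v); edge gC gA.
- by apply: (free a c b w e e v); edge gC gA.
- by apply: (free b e v w a c b); edge gC gA.
- by apply: (free b v e w a c a); edge gC gA.
- by apply: (free b v e w a a v); edge gC gA.
- by apply: (free a w b e v v a); edge gC gA.
- by apply: (free b v e w a c v); edge gC gA.
- by apply: (free e v b c a w e); edge gC gA.
- by apply: (free e w a c v b e); edge gC gA.
- by apply: (free v w a c e b e); edge gC gA.
Qed.

(* The weights are an optimal dual solution of the linear program that bounds
   the link of [w]; uniform weights fail when this link is the 5-cycle abevc. *)
Lemma K4minus_ext_link (I : Type) (g : I -> I -> I -> bool)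
    (a b c e v w : I) :
  symmetric3 g -> F1_hom_free g -> K4minus_ext g a b c e v ->
  3 * (g w a b + g w b e) + 2 * (g w a c + g w e v) + 4 * g w a e
  + 3 * (g w a v + g w c e) + 4 * (g w b c + g w b v) + 2 * g w c v <= 12.
Proof.
move=> gS free abcev; have [gC gA] := gS.
(* The automorphism supplies the mirror images of the listed patterns; the weights are invariant
   under it. They sum to 30, and 12 is again 2/5 of the total. *)
have ebvac : K4minus_ext g e b v a c.
  case/and4P: abcev => /and3P[? ? ?] ? ? ?.
  by apply/and4P; split; [apply/and3P; split|..]; edge gC gA.
have := K4minus_ext_forbidden w gS free abcev.
have := K4minus_ext_forbidden w gS free ebvac.
rewrite (gA w e b) (gA w e a) (gA w e c) (gA w b a) (gA w v a) (gA w v c).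
case: (g w a b); case: (g w a c); case: (g w a e); case: (g w a v);
case: (g w b c); case: (g w b e); case: (g w b v); case: (g w c e);
by case: (g w c v); case: (g w e v).
Qed.

(** The copies counted on the right are those on {a, b, c, d} that contain the edge abc: one if d
    extends two of its pairs, three if d extends all of them. *)
Lemma edge_K4minus (I : Type) (g : I -> I -> I -> bool) (a b c d : I) :
  symmetric3 g ->
  g a b c * g d a b + g a b c * g d a c + g a b c * g d b c
  <= g a b c + (K4minus g d b c a + K4minus g a d c b + K4minus g a b d c).
Proof.
case=> gC gA; rewrite /K4minus (gA b c a) (gC b a c) (gA a c b).
rewrite (gA d b a) (gA d c a) (gA d c b) (gC a d) (gC a d) (gC b d).
by case: (g a b c); case: (g d a b); case: (g d a c); case: (g d b c).
Qed.

(** * Degenerate copies of F1 with rich bases *)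

Definition hedge (T : finType) (H : {set {set T}}) (x y z : T) : bool :=
  [set x; y; z]%SET \in H.

Lemma hedge_symmetric3 (T : finType) (H : {set {set T}}) :
  symmetric3 (hedge H).
Proof.
split=> x y z; rewrite /hedge; first by rewrite (finset.setUC [set x]%SET).
by rewrite -!finset.setUA (finset.setUC [set y]%SET).
Qed.

Lemma hedge_neq (T : finType) (H : {set {set T}}) (x y z : T) :
  is_3graph H -> hedge H x y z -> [&& x != y, x != z & y != z].
Proof.
move=> /forall_inP H3 /H3; rewrite finset.setUC cardsU1 cards2 !inE negb_or.
by rewrite ![z == _]eq_sym; case: (x == y); case: (x == z); case: (y == z).
Qed.

Lemma contains_F1 (T : finType) (H : {set {set T}}) (a b c d e f g : T) :
  uniq [:: a; b; c; d; e; f; g] ->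
  hedge H a b e -> hedge H a c e -> hedge H b c e ->
  hedge H a b f -> hedge H a d f -> hedge H b d f -> hedge H c d g ->
  contains F1 H.
Proof.
move=> uniq_s abe ace bce abf adf bdf cdg; set s := [:: a; b; c; d; e; f; g].
apply/existsP; exists [ffun i : 'I_7 => nth a s i]; apply/andP; split.
  apply/injectiveP=> i j; rewrite !ffunE => /eqP.
  by rewrite nth_uniq // => /eqP/val_inj.
have im (p q r : nat) : p < 7 -> q < 7 -> r < 7 ->
    hedge H (nth a s p) (nth a s q) (nth a s r) ->
  [set [ffun i : 'I_7 => nth a s i] x
     | x in [set inord p; inord q; inord r]]%SET \in H.
  by move=> p7 q7 r7; rewrite !imsetU !imset_set1 !ffunE !inordK.
apply/forall_inP=> E; rewrite !inE -!orbA.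
by do 6?[case/orP]; move=> /eqP->; apply: im.
Qed.

(** Every edge containing x and y has the form {x, y, t}, so the edges counted by the codegree are
    images of such t. *)
Lemma pos_codeg_hedge (T : finType) (H : {set {set T}}) (k : nat) (x y z : T) :
  is_3graph H -> pos_codeg_ge H k -> hedge H x y z ->
  k <= #|[set t | hedge H x y t]%SET|.
Proof.
move=> H3 /forallP/(_ [set x; y]%SET)/implyP codegP xyz.
have /and3P[xy _ _] := hedge_neq H3 xyz.
have /codegP : (#|[set x; y]%SET| == 2)
    && [exists e in H, [set x; y]%SET \subset e].
  rewrite cards2 xy /=; apply/exists_inP; exists [set x; y; z]%SET => //.
  exact: finset.subsetUl.
move/leq_trans; apply; rewrite /codeg.
apply: (leq_trans _ (leq_imset_card (fun t => [set x; y; t]%SET) _)).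
apply/subset_leq_card/fintype.subsetP=> e; rewrite inE => /andP[eH xye].
have e3 : #|e| == 3 by move/forall_inP: H3; apply.
have /cards1P[t et] : #|e :\: [set x; y]|%SET == 1.
  by rewrite cardsDS // cards2 xy (eqP e3).
have eE : e = [set x; y; t]%SET.
  by rewrite -et -{1}(finset.setID e [set x; y]%SET) (finset.setIidPr xye).
by apply/imsetP; exists t; rewrite // inE /hedge -eE.
Qed.

Definition rich (T : finType) (H : {set {set T}}) (a b c : T) : bool :=
  2 < #|[set e | K4minus (hedge H) a b c e]%SET|.

Lemma exists_notin (T : finType) (A : {set T}) (s : seq T) :
  size s < #|A| -> exists2 x, x \in A & x \notin s.
Proof.
move=> lt_s; have : ~~ (A \subset [set x in s]%SET).
  apply/negP=> /subset_leq_card; rewrite leqNgt cardsE.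
  by rewrite (leq_ltn_trans (card_size s)).
by case/subsetPn=> x xA; rewrite inE; exists x.
Qed.

(* The apexes can be chosen distinct from each other and from the remaining
   vertices, so a degenerate copy of F1 suffices. *)
Lemma rich_contains_F1 (T : finType) (H : {set {set T}}) (k : nat)
    (a b c d s : T) :
  is_3graph H -> pos_codeg_ge H k -> 4 < k ->
  rich H a b c -> rich H a b d -> hedge H c d s -> contains F1 H.
Proof.
move=> H3 Hk k4 abc abd cds.
(* The edges at e already separate it from a, b, c, so it must only avoid d; f must avoid c and e,
   and g must avoid a, b, e, f. Hence the thresholds 2 in [rich] and 4 for [k]. *)
have [e] := @exists_notin _ _ [:: d] (ltnW abc).
rewrite !inE => /and3P[abe ace bce] ed.
have [f] := @exists_notin _ _ [:: c; e] abd.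
rewrite !inE negb_or => /and3P[abf adf bdf] /andP[fc fe].
have [g] := @exists_notin _ _ [:: a; b; e; f]
  (leq_trans k4 (pos_codeg_hedge H3 Hk cds)).
rewrite !inE !negb_or => cdg /and4P[ga gb ge gf].
apply: (contains_F1 _ abe ace bce abf adf bdf cdg).
have /and3P[ab ae be] := hedge_neq H3 abe.
have /and3P[ac _ ce] := hedge_neq H3 ace.
have /and3P[bc _ _] := hedge_neq H3 bce.
have /and3P[_ af bf] := hedge_neq H3 abf.
have /and3P[ad _ df] := hedge_neq H3 adf.
have /and3P[bd _ _] := hedge_neq H3 bdf.
have /and3P[cd cg dg] := hedge_neq H3 cdg.
rewrite /= !inE !negb_or ab ac ad ae af bc bd be bf cd ce cg df dg.
rewrite ![_ == g]eq_sym ga gb ge gf.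
by rewrite (eq_sym d) ed (eq_sym c f) fc (eq_sym e) fe.
Qed.

(** * Counting 6-tuples *)

Definition upd (I V : finType) (x : {ffun I -> V}) (l : I) (y : V) :
    {ffun I -> V} :=
  [ffun i => if i == l then y else x i].

Lemma updE (I V : finType) (x : {ffun I -> V}) (l : I) (y : V) (i : I) :
  upd x l y i = if i == l then y else x i.
Proof. by rewrite ffunE. Qed.

(** Exchanging the coordinate [x l] with the new value [y] is an involution on pairs [(x, y)]. *)
Lemma sum_upd (I V : finType) (l : I) (F : {ffun I -> V} -> nat) :
  #|V| * (\sum_x F x) = \sum_x \sum_y F (upd x l y).
Proof.
pose sw (p : {ffun I -> V} * V) := (upd p.1 l p.2, p.1 l).
have swK : involutive sw.
  move=> [x y]; rewrite /sw /= updE eqxx; congr (_, _).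
  by apply/ffunP=> i; rewrite !updE; case: eqP => [->|].
rewrite pair_big /= (reindex_inj (inv_inj swK)) /=.
rewrite -(pair_big predT predT (fun x y => F (upd (upd x l y) l (x l)))) /=.
rewrite big_distrr /=; apply: eq_bigr => x _.
rewrite (eq_bigr (fun=> F x)) ?sum_nat_const // => y _; congr F.
by apply/ffunP=> i; rewrite !updE; case: eqP => [->|].
Qed.

(** The basic counting step: [F], [u] and [v] ignore coordinate [l], so this coordinate can be
    resampled, and at least [k] of its values complete the covered pair [u x], [v x] to an edge. *)
Lemma sum_extend (I V : finType) (H : {set {set V}}) (k : nat) (l : I)
    (F : {ffun I -> V} -> nat) (u v : {ffun I -> V} -> V) :
  is_3graph H -> pos_codeg_ge H k ->
  (forall x y, F (upd x l y) = F x) ->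
  (forall x y, u (upd x l y) = u x) -> (forall x y, v (upd x l y) = v x) ->
  (forall x, 0 < F x -> exists z, hedge H (u x) (v x) z) ->
  k * (\sum_x F x) <= #|V| * (\sum_x F x * hedge H (x l) (u x) (v x)).
Proof.
move=> H3 Hk Fl ul vl covF; rewrite (sum_upd l) big_distrr /=.
apply: leq_sum => x _.
under eq_bigr do rewrite Fl ul vl updE eqxx.
rewrite -big_distrr /= mulnC.
have [->//|/covF[z uvz]] := posnP (F x).
rewrite leq_mul2l; apply/orP; right.
apply: leq_trans (pos_codeg_hedge H3 Hk uvz) _.
have [hC hA] := hedge_symmetric3 H.
rewrite -sum1_card big_mkcond leq_sum // => y _; rewrite inE hA hC.
by case: hedge.
Qed.

Definition thin (T : finType) (H : {set {set T}}) (a b c e : T) : bool :=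
  K4minus (hedge H) a b c e && ~~ rich H a b c.

Definition has_thin (I T : finType) (H : {set {set T}}) (x : {ffun I -> T}) :
    bool :=
  [exists p : I * I * I * I,
     thin H (x p.1.1.1) (x p.1.1.2) (x p.1.2) (x p.2)].

(** Once the three base vertices are fixed and not rich, at most two values remain for the apex
    coordinate. An apex index among the base indices gives no copy at all. *)
Lemma sum_thin (I T : finType) (H : {set {set T}}) (i j m l : I) :
  is_3graph H ->
  #|T| * (\sum_(x : {ffun I -> T}) thin H (x i) (x j) (x m) (x l))
    <= 2 * #|T| ^ #|I|.
Proof.
move=> H3; case: (boolP (l \in [:: i; j; m])) => [lijm|].
  rewrite big1 ?muln0 // => x _; apply/eqP; rewrite eqb0.
  apply/negP=> /andP[/and3P[e1 e2 _] _].
  have /and3P[_ + +] := hedge_neq H3 e1; have /and3P[_ _ +] := hedge_neq H3 e2.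
  by move: lijm; rewrite !inE => /or3P[]/eqP->; rewrite eqxx.
rewrite !inE !negb_or => /and3P[li lj lm].
rewrite (sum_upd l) mulnC -card_ffun -sum_nat_const; apply: leq_sum => x _.
under eq_bigr do
  rewrite !updE !(eq_sym _ l) (negPf li) (negPf lj) (negPf lm) eqxx.
rewrite /thin; case: (boolP (rich _ _ _ _)) => [_|]; last rewrite -leqNgt.
  by rewrite big1 // => y _; rewrite andbF.
apply: leq_trans; rewrite -sum1_card [leqRHS]big_mkcond /=.
by apply: leq_sum => y _; rewrite inE andbT; case: K4minus.
Qed.

(** Union bound over the [#|I| ^ 4] choices of base and apex coordinates. *)
Lemma sum_has_thin (I T : finType) (H : {set {set T}}) :
  is_3graph H ->
  #|T| * (\sum_(x : {ffun I -> T}) has_thin H x)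
    <= 2 * #|I| ^ 4 * #|T| ^ #|I|.
Proof.
move=> H3.
pose P p (x : {ffun I -> T}) :=
  thin H (x p.1.1.1) (x p.1.1.2) (x p.1.2) (x p.2) : nat.
apply: (@leq_trans (#|T| * (\sum_x \sum_(p : I * I * I * I) P p x))).
  rewrite leq_mul2l; apply/orP; right; apply: leq_sum => x _.
  case: (boolP (has_thin H x)) => // /existsP[p pP].
  by rewrite (bigD1 p) //= {1}/P pP.
rewrite exchange_big big_distrr /=.
apply: (@leq_trans (\sum_(p : I * I * I * I) 2 * #|T| ^ #|I|)).
  by apply: leq_sum => p _; apply: sum_thin.
rewrite sum_nat_const !card_prod !expnS expn0 muln1.
by rewrite !mulnA [_ * 2]mulnC !mulnA.
Qed.

(** In a degenerate copy of F1 on the indices, both copies of $K_4^-$ have rich bases because [x]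
    has no thin copy, so a genuine F1 can be embedded. *)
Lemma F1_hom_free_of_not_thin (I T : finType) (H : {set {set T}}) (k : nat)
    (x : {ffun I -> T}) :
  is_3graph H -> pos_codeg_ge H k -> 4 < k -> ~~ contains F1 H ->
  ~~ has_thin H x -> F1_hom_free (fun i j l => hedge H (x i) (x j) (x l)).
Proof.
move=> H3 Hk k4 noF1 /existsPn nothin a b c d e f s abe ace bce abf adf bdf cds.
have rich_of p q r t : K4minus (hedge H) (x p) (x q) (x r) (x t) ->
    rich H (x p) (x q) (x r).
  by move=> pqrt; have := nothin (p, q, r, t); rewrite /thin pqrt negbK.
move/negP: noF1; apply; apply: (rich_contains_F1 H3 Hk k4 _ _ cds).
  by apply: (rich_of a b c e); apply/and3P.
by apply: (rich_of a b d f); apply/and3P.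
Qed.

Lemma sum_tperm (I V : finType) (i j : I) (F : {ffun I -> V} -> nat) :
  \sum_(x : {ffun I -> V}) F [ffun m => x (tperm i j m)] = \sum_x F x.
Proof.
have swK : involutive (fun x : {ffun I -> V} => [ffun m => x (tperm i j m)]).
  by move=> x; apply/ffunP=> m; rewrite !ffunE tpermK.
by rewrite [RHS](reindex_inj (inv_inj swK)).
Qed.

(** * Edges, copies of $K_4^-$ and their extensions among 6-tuples *)

Local Notation ord6 k := (@Ordinal 6 k isT) (only parsing).

(** The six coordinates stand for a, b, c, e, v, w. All configurations are counted over 6-tuples,
    the remaining coordinates being free, so that every count compares with [#|V| ^ 6]. *)
Definition edge_at (V : finType) (H : {set {set V}}) (x : {ffun 'I_6 -> V}) :
    bool :=
  hedge H (x (ord6 0)) (x (ord6 1)) (x (ord6 2)).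

Definition K4minus_at (V : finType) (H : {set {set V}})
    (x : {ffun 'I_6 -> V}) : bool :=
  K4minus (hedge H) (x (ord6 0)) (x (ord6 1)) (x (ord6 2)) (x (ord6 3)).

Definition K4minus_ext_at (V : finType) (H : {set {set V}})
    (x : {ffun 'I_6 -> V}) : bool :=
  K4minus_ext (hedge H)
    (x (ord6 0)) (x (ord6 1)) (x (ord6 2)) (x (ord6 3)) (x (ord6 4)).

(** Starting from the edge pqr, coordinate 0 is chosen in the link of pq, coordinate 1 in that of
    [x 0] and p, and coordinate 2 in that of [x 0] and [x 1], with at least [k] choices each
    time. *)
Lemma sum_edge_at (V : finType) (H : {set {set V}}) (k : nat) (p q r : V) :
  is_3graph H -> pos_codeg_ge H k -> hedge H p q r ->
  k ^ 3 * #|V| ^ 6 <= #|V| ^ 3 * (\sum_x edge_at H x).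
Proof.
move=> H3 Hk pqr; have [hC hA] := hedge_symmetric3 H.
set h := hedge H in pqr hC hA *; set n := #|V|.
pose G1 (x : {ffun 'I_6 -> V}) := 1 * h (x (ord6 0)) p q.
pose G2 (x : {ffun 'I_6 -> V}) := G1 x * h (x (ord6 1)) (x (ord6 0)) p.
have s1 : k * (\sum_(x : {ffun 'I_6 -> V}) 1) <= n * (\sum_x G1 x).
  apply: (sum_extend (u := fun=> p) (v := fun=> q) H3 Hk) => // x _.
  by exists r.
have s2 : k * (\sum_x G1 x) <= n * (\sum_x G2 x).
  apply: (sum_extend (u := fun x => x (ord6 0)) (v := fun=> p) H3 Hk)
    => [x y|x y|x y|x]; rewrite /G1 ?updE //=.
  by case: (boolP (h _ _ _)) => // e _; exists q.
have s3 : k * (\sum_x G2 x) <= n * (\sum_x edge_at H x).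
  apply: (@leq_trans
    (n * (\sum_x G2 x * h (x (ord6 2)) (x (ord6 0)) (x (ord6 1))))).
    apply: (sum_extend (u := fun x => x (ord6 0))
      (v := fun x => x (ord6 1)) H3 Hk) => [x y|x y|x y|x];
      rewrite /G2 /G1 ?updE //=.
    case: (boolP (h (x (ord6 1)) _ _)) => [e _|_]; last by rewrite muln0.
    by exists p; rewrite -/h hC.
  rewrite leq_mul2l leq_sum ?orbT // => x _; rewrite /G2 /G1 /edge_at -/h.
  rewrite [h (x (ord6 2)) _ _]hC (hA (x (ord6 0)) (x (ord6 2))).
  by case: (h _ p q); case: (h _ _ p); case: (h _ _ _).
rewrite sum1_card card_ffun card_ord -/n in s1.
rewrite !(expnSr _ 2) !(expnSr _ 1) !expn1 -!mulnA.
apply: (@leq_trans (k * (k * (n * (\sum_x G1 x))))).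
  by rewrite !leq_mul2l s1 !orbT.
rewrite !(mulnCA k n); apply: (@leq_trans (n * (k * (n * (\sum_x G2 x))))).
  by rewrite !leq_mul2l s2 !orbT.
by rewrite !(mulnCA k n) !leq_mul2l s3 !orbT.
Qed.

Lemma sum_K4minus_at (V : finType) (H : {set {set V}}) (k : nat) :
  is_3graph H -> pos_codeg_ge H k ->
  3 * k * (\sum_x edge_at H x)
    <= #|V| * (\sum_x edge_at H x + 3 * \sum_x K4minus_at H x).
Proof.
move=> H3 Hk; have [hC hA] := hedge_symmetric3 H.
set h := hedge H in hC hA *; set n := #|V|.
pose E x := edge_at H x : nat.
have ext (i j : 'I_6) : i != ord6 3 -> j != ord6 3 ->
    (forall x, 0 < E x -> exists z, h (x i) (x j) z) ->
    k * (\sum_x E x)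
    <= n * (\sum_x E x * h (x (ord6 3)) (x i) (x j)).
  move=> i3 j3.
  apply: (sum_extend (u := fun x => x i) (v := fun x => x j) H3 Hk) => x y;
    rewrite /E /edge_at ?updE //=; first by rewrite (negPf i3).
  by rewrite (negPf j3).
have s01 :
    k * (\sum_x E x)
    <= n * (\sum_x E x * h (x (ord6 3)) (x (ord6 0)) (x (ord6 1))).
  by apply: ext => // x; rewrite lt0b => e; exists (x (ord6 2)).
have s02 :
    k * (\sum_x E x)
    <= n * (\sum_x E x * h (x (ord6 3)) (x (ord6 0)) (x (ord6 2))).
  apply: ext => // x; rewrite lt0b => e; exists (x (ord6 1)).
  by rewrite hA.
have s12 :
    k * (\sum_x E x)
    <= n * (\sum_x E x * h (x (ord6 3)) (x (ord6 1)) (x (ord6 2))).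
  apply: ext => // x; rewrite lt0b => e; exists (x (ord6 0)).
  by rewrite hA hC.
have -> : 3 * k * (\sum_x E x)
    = k * (\sum_x E x) + k * (\sum_x E x) + k * (\sum_x E x).
  by rewrite -mulnA !mulSn mul0n addn0 addnA.
apply: leq_trans (leq_add (leq_add s01 s02) s12) _.
rewrite -!mulnDr -!big_split /= leq_mul2l; apply/orP; right.
have sK (i j : 'I_6) := sum_tperm i j (fun x => K4minus_at H x : nat).
have -> : 3 * (\sum_x K4minus_at H x) =
  (\sum_x K4minus_at H x) + (\sum_x K4minus_at H x) + (\sum_x K4minus_at H x).
  by rewrite !mulSn addn0 addnA.
(* Swapping coordinate 3 with 0, 1 or 2 moves the apex onto a vertex of the edge, which produces the
   three copies in [edge_K4minus]. *)
rewrite -{1}(sK (ord6 0) (ord6 3)) -{1}(sK (ord6 1) (ord6 3)).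
rewrite -{1}(sK (ord6 2) (ord6 3)) -!big_split /=; apply: leq_sum => x _.
rewrite /E /edge_at /K4minus_at /K4minus !ffunE !permE /= -/h.
exact: (edge_K4minus _ _ _ _ (hedge_symmetric3 H)).
Qed.

Lemma sum_K4minus_ext_at (V : finType) (H : {set {set V}}) (k : nat) :
  is_3graph H -> pos_codeg_ge H k -> 4 < k -> ~~ contains F1 H ->
  15 * k * (\sum_x K4minus_at H x)
    <= #|V| * (6 * (\sum_x K4minus_at H x) + 6 * (\sum_x K4minus_ext_at H x)
               + 15 * \sum_(x : {ffun 'I_6 -> V}) has_thin H x).
Proof.
move=> H3 Hk k4 noF1; have [hC hA] := hedge_symmetric3 H.
set h := hedge H in hC hA *; set n := #|V|.
pose K x := K4minus_at H x : nat.
have ext (i j : 'I_6) : i != ord6 4 -> j != ord6 4 ->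
    (forall x, 0 < K x -> exists z, h (x i) (x j) z) ->
    k * (\sum_x K x)
    <= n * (\sum_x K x * h (x (ord6 4)) (x i) (x j)).
  move=> i4 j4.
  apply: (sum_extend (u := fun x => x i) (v := fun x => x j) H3 Hk) => x y;
    rewrite /K /K4minus_at ?updE //=; first by rewrite (negPf i4).
  by rewrite (negPf j4).
have s01 :
    k * (\sum_x K x)
    <= n * (\sum_x K x * h (x (ord6 4)) (x (ord6 0)) (x (ord6 1))).
  by apply: ext => // x; rewrite lt0b => /and3P[? ? ?]; exists (x (ord6 3)).
have s02 :
    k * (\sum_x K x)
    <= n * (\sum_x K x * h (x (ord6 4)) (x (ord6 0)) (x (ord6 2))).
  by apply: ext => // x; rewrite lt0b => /and3P[? ? ?]; exists (x (ord6 3)).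
have s12 :
    k * (\sum_x K x)
    <= n * (\sum_x K x * h (x (ord6 4)) (x (ord6 1)) (x (ord6 2))).
  by apply: ext => // x; rewrite lt0b => /and3P[? ? ?]; exists (x (ord6 3)).
have s03 :
    k * (\sum_x K x)
    <= n * (\sum_x K x * h (x (ord6 4)) (x (ord6 0)) (x (ord6 3))).
  apply: ext => // x; rewrite lt0b => /and3P[? ? ?]; exists (x (ord6 1)).
  by rewrite hA.
have s13 :
    k * (\sum_x K x)
    <= n * (\sum_x K x * h (x (ord6 4)) (x (ord6 1)) (x (ord6 3))).
  apply: ext => // x; rewrite lt0b => /and3P[? ? ?]; exists (x (ord6 0)).
  by rewrite hA hC.
have s23 :
    k * (\sum_x K x)
    <= n * (\sum_x K x * h (x (ord6 4)) (x (ord6 2)) (x (ord6 3))).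
  apply: ext => // x; rewrite lt0b => /and3P[? ? ?]; exists (x (ord6 0)).
  by rewrite hA hC.
pose q (i j l : 'I_6) (x : {ffun 'I_6 -> V}) : nat :=
  K4minus_ext h (x i) (x j) (x l) (x (ord6 3)) (x (ord6 4)).
(* One transposition gives three of the orders of coordinates 0, 1, 2; products of two give the
   3-cycles. *)
have sQ (i j : 'I_6) := sum_tperm i j (fun x => K4minus_ext_at H x : nat).
have sQ2 (i j l m : 'I_6) := etrans (sum_tperm i j
  (fun x => K4minus_ext_at H [ffun p => x (tperm l m p)] : nat)) (sQ l m).
have sumQ : 6 * (\sum_x K4minus_ext_at H x) =
    \sum_x (q (ord6 0) (ord6 1) (ord6 2) x + q (ord6 1) (ord6 0) (ord6 2) x
      + q (ord6 0) (ord6 2) (ord6 1) x + q (ord6 2) (ord6 0) (ord6 1) x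
      + q (ord6 1) (ord6 2) (ord6 0) x + q (ord6 2) (ord6 1) (ord6 0) x).
  transitivity ((\sum_x K4minus_ext_at H x) + (\sum_x K4minus_ext_at H x)
    + (\sum_x K4minus_ext_at H x) + (\sum_x K4minus_ext_at H x)
    + (\sum_x K4minus_ext_at H x) + (\sum_x K4minus_ext_at H x)); first by lia.
  rewrite -{2}(sQ (ord6 0) (ord6 1)) -{2}(sQ (ord6 1) (ord6 2)).
  rewrite -{2}(sQ2 (ord6 1) (ord6 2) (ord6 0) (ord6 1)).
  rewrite -{2}(sQ2 (ord6 0) (ord6 1) (ord6 1) (ord6 2)).
  rewrite -{2}(sQ (ord6 0) (ord6 2)) -!big_split /=; apply: eq_bigr => x _.
  by rewrite /q /K4minus_ext_at !ffunE !permE /= ?permE.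
rewrite sumQ.
have arith S a b c d e f : k * S <= n * a -> k * S <= n * b ->
    k * S <= n * c -> k * S <= n * d -> k * S <= n * e -> k * S <= n * f ->
    15 * k * S <= n * (2 * (a + b + c) + 3 * (d + e + f)).
  by clear; lia.
apply: leq_trans (arith _ _ _ _ _ _ _ s01 s02 s12 s03 s13 s23) _.
rewrite leq_mul2l -!big_split !big_distrr -!big_split /=; apply/orP; right.
apply: leq_sum => x _; rewrite /K.
case: (boolP (K4minus_at H x)) => [Kx|]; last by rewrite !mul0n.
rewrite !mul1n; have [x_thin|x_thick] := boolP (has_thin H x).
  (* A tuple with a thin copy may carry the whole weight. *)
  apply: (@leq_trans 15); last by rewrite muln1 leq_addl.
  by do 6!case: (h _ _ _).
apply: leq_trans (leq_addr _ _).
apply: (@K4minus_link _ (fun i j l => h (x i) (x j) (x l))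
  (ord6 0) (ord6 1) (ord6 2) (ord6 3) (ord6 4) _ _ Kx).
  by split=> i j l; [apply: hC|apply: hA].
exact: (F1_hom_free_of_not_thin H3 Hk k4 noF1).
Qed.

(** The main terms compare 30 k with 12 n, so k above 2n/5 forces many tuples with a thin copy. *)
Lemma sum_K4minus_ext_at_thin (V : finType) (H : {set {set V}}) (k : nat) :
  is_3graph H -> pos_codeg_ge H k -> 4 < k -> ~~ contains F1 H ->
  30 * k * (\sum_x K4minus_ext_at H x)
    <= #|V| * (12 * (\sum_x K4minus_ext_at H x)
               + 30 * \sum_(x : {ffun 'I_6 -> V}) has_thin H x).
Proof.
move=> H3 Hk k4 noF1; have [hC hA] := hedge_symmetric3 H.
set h := hedge H in hC hA *; set n := #|V|.
pose Q x := K4minus_ext_at H x : nat.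
pose w (i j : 'I_6) (x : {ffun 'I_6 -> V}) : nat :=
  Q x * h (x (ord6 5)) (x i) (x j).
have ext (i j : 'I_6) : i != ord6 5 -> j != ord6 5 ->
    (forall x, 0 < Q x -> exists z, h (x i) (x j) z) ->
    k * (\sum_x Q x) <= n * (\sum_x w i j x).
  move=> i5 j5.
  apply: (sum_extend (u := fun x => x i) (v := fun x => x j) H3 Hk) => x y;
    rewrite /Q /K4minus_ext_at ?updE //=; first by rewrite (negPf i5).
  by rewrite (negPf j5).
have s01 : k * (\sum_x Q x) <= n * (\sum_x w (ord6 0) (ord6 1) x).
  apply: ext => // x; rewrite lt0b => /and4P[/and3P[? ? ?] ? ? ?].
  by exists (x (ord6 3)); edge hC hA.
have s13 : k * (\sum_x Q x) <= n * (\sum_x w (ord6 1) (ord6 3) x).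
  apply: ext => // x; rewrite lt0b => /and4P[/and3P[? ? ?] ? ? ?].
  by exists (x (ord6 0)); edge hC hA.
have s02 : k * (\sum_x Q x) <= n * (\sum_x w (ord6 0) (ord6 2) x).
  apply: ext => // x; rewrite lt0b => /and4P[/and3P[? ? ?] ? ? ?].
  by exists (x (ord6 3)); edge hC hA.
have s34 : k * (\sum_x Q x) <= n * (\sum_x w (ord6 3) (ord6 4) x).
  apply: ext => // x; rewrite lt0b => /and4P[/and3P[? ? ?] ? ? ?].
  by exists (x (ord6 0)); edge hC hA.
have s03 : k * (\sum_x Q x) <= n * (\sum_x w (ord6 0) (ord6 3) x).
  apply: ext => // x; rewrite lt0b => /and4P[/and3P[? ? ?] ? ? ?].
  by exists (x (ord6 1)); edge hC hA.
have s04 : k * (\sum_x Q x) <= n * (\sum_x w (ord6 0) (ord6 4) x).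
  apply: ext => // x; rewrite lt0b => /and4P[/and3P[? ? ?] ? ? ?].
  by exists (x (ord6 3)); edge hC hA.
have s23 : k * (\sum_x Q x) <= n * (\sum_x w (ord6 2) (ord6 3) x).
  apply: ext => // x; rewrite lt0b => /and4P[/and3P[? ? ?] ? ? ?].
  by exists (x (ord6 0)); edge hC hA.
have s12 : k * (\sum_x Q x) <= n * (\sum_x w (ord6 1) (ord6 2) x).
  apply: ext => // x; rewrite lt0b => /and4P[/and3P[? ? ?] ? ? ?].
  by exists (x (ord6 3)); edge hC hA.
have s14 : k * (\sum_x Q x) <= n * (\sum_x w (ord6 1) (ord6 4) x).
  apply: ext => // x; rewrite lt0b => /and4P[/and3P[? ? ?] ? ? ?].
  by exists (x (ord6 0)); edge hC hA.
have s24 : k * (\sum_x Q x) <= n * (\sum_x w (ord6 2) (ord6 4) x).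
  apply: ext => // x; rewrite lt0b => /and4P[/and3P[? ? ?] ? ? ?].
  by exists (x (ord6 1)); edge hC hA.
have arith S a b c d e f g i j l : k * S <= n * a -> k * S <= n * b ->
    k * S <= n * c -> k * S <= n * d -> k * S <= n * e -> k * S <= n * f ->
    k * S <= n * g -> k * S <= n * i -> k * S <= n * j -> k * S <= n * l ->
    30 * k * S <= n * (3 * (a + b) + 2 * (c + d) + 4 * e + 3 * (f + g)
                       + 4 * (i + j) + 2 * l).
  by clear; lia.
apply: leq_trans
  (arith _ _ _ _ _ _ _ _ _ _ _ s01 s13 s02 s34 s03 s04 s23 s12 s14 s24) _.
rewrite leq_mul2l -!big_split !big_distrr -!big_split /=; apply/orP; right.
apply: leq_sum => x _; rewrite /w /Q.
case: (boolP (K4minus_ext_at H x)) => [Qx|]; last by rewrite !mul0n.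
rewrite !mul1n; have [x_thin|x_thick] := boolP (has_thin H x).
  apply: (@leq_trans 30); last by rewrite muln1 leq_addl.
  by do 10!case: (h _ _ _).
apply: leq_trans (leq_addr _ _).
apply: (@K4minus_ext_link _ (fun i j l => h (x i) (x j) (x l))
  (ord6 0) (ord6 1) (ord6 2) (ord6 3) (ord6 4) (ord6 5) _ _ Qx).
  by split=> i j l; [apply: hC|apply: hA].
exact: (F1_hom_free_of_not_thin H3 Hk k4 noF1).
Qed.

(** * The upper bound *)

(** Positivity excludes the empty maximum, whose value is 0. *)
Lemma bigmax_attained (I : finType) (P : pred I) (F : I -> nat) :
  0 < \max_(i | P i) F i -> exists2 i, P i & \max_(i | P i) F i = F i.
Proof.
move=> max_gt0; have [|P0] := posnP #|P|.
  by move=> /card0_eq P0; rewrite big_pred0 in max_gt0.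
by have [i Pi maxE] := eq_bigmax_cond F P0; exists i.
Qed.

Lemma min_pos_codeg_ge (T : finType) (H : {set {set T}}) :
  pos_codeg_ge H (min_pos_codeg H).
Proof.
have codeg0 : pos_codeg_ge H 0 by apply/forallP=> p; apply/implyP.
rewrite /min_pos_codeg; case: eqP => // _.
have [-> //|] := posnP (\max_(k < #|T|.+1 | pos_codeg_ge H k) k).
by move=> /bigmax_attained[k Hk ->].
Qed.

Lemma min_pos_codeg_edge (T : finType) (H : {set {set T}}) :
  is_3graph H -> 0 < min_pos_codeg H -> exists a b c, hedge H a b c.
Proof.
move=> H3; rewrite /min_pos_codeg; case: eqP => // /eqP/set0Pn[e eH] _.
have /forall_inP/(_ e eH) e3 := H3.
have /card_gt0P[a ae] : 0 < #|e| by rewrite (eqP e3).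
have /cards2P[b [c [_ bcE]]] : #|e :\ a|%SET == 2.
  by move: e3; rewrite (cardsD1 a) ae.
exists a, b, c.
by rewrite /hedge -finset.setUA -bcE finset.setD1K.
Qed.

Lemma pos_codeg_F1_free (R : realFieldType) (V : finType)
    (H : {set {set V}}) (k : nat) (e : R) :
  is_3graph H -> pos_codeg_ge H k -> ~~ contains F1 H ->
  (exists a b c, hedge H a b c) ->
  (0 < e <= 1)%R -> ((2 / 5 + e) * #|V|%:R <= k%:R)%R ->
  (e ^+ 2 * #|V|%:R <= 1000 * 1000)%R.
Proof.
move=> H3 Hk noF1 [p [q [r pqr]]] /andP[e0 e1].
have e2 : (0 < e ^+ 2 <= 1)%R by rewrite exprn_gt0 // exprn_ile1 // ltW.
(* From n >= 11 on, 2n/5 exceeds 4, which gives the [4 < k] of the embedding lemma. *)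
set n := #|V| => nk; have [n10|n10] := leqP n 10.
  have : (n%:R <= 10 :> R)%R by rewrite ler_nat.
  by nra.
have k4 : 4 < k.
  rewrite -(ltr_nat R); apply: lt_le_trans nk.
  have : (11 <= n%:R :> R)%R by rewrite ler_nat.
  by nra.
have n0 : (0 < n%:R :> R)%R by rewrite ltr0n (leq_trans _ n10).
have := sum_has_thin 'I_6 H3; have := sum_K4minus_ext_at_thin H3 Hk k4 noF1.
have := sum_K4minus_ext_at H3 Hk k4 noF1; have := sum_K4minus_at H3 Hk.
have := sum_edge_at H3 Hk pqr; rewrite card_ord -/n.
move: (\sum_x edge_at H x) => A; move: (\sum_x K4minus_at H x) => B.
move: (\sum_x K4minus_ext_at H x) => Q.
move: (\sum_(x : {ffun 'I_6 -> V}) has_thin H x) => D.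
rewrite -!(ler_nat R) [(k ^ 3 * _)%:R%R]natrM [(n ^ 3 * _)%:R%R]natrM.
rewrite [(2 * 6 ^ 4 * _)%:R%R]natrM [(k ^ 3)%:R%R]natrX [(n ^ 3)%:R%R]natrX.
rewrite [(n ^ 6)%:R%R]natrX.
set C := (2 * 6 ^ 4)%:R%R; have CE : (C <= 2592)%R by rewrite ler_nat.
rewrite !(natrM, natrD).
have := ler0n R A; have := ler0n R B; have := ler0n R Q; have := ler0n R D.
move: C n%:R%R k%:R%R A%:R%R B%:R%R Q%:R%R D%:R%R CE n0 nk.
move=> {A B Q D n10} C {}n k' A B Q D CE n0 nk D0 Q0 B0 A0 hA hB hQ hD hn.
have N0 : (0 < n ^+ 6)%R by apply: exprn_gt0.
have k0 : (2 / 5 * n <= k')%R by nra.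
have A1 : (8 / 125 * n ^+ 6 <= A)%R.
  have k3 : ((2 / 5 * n) ^+ 3 <= k' ^+ 3)%R by rewrite lerXn2r ?nnegrE //; nra.
  rewrite -(ler_pM2l (exprn_gt0 3 n0)); apply: le_trans hA.
  apply: le_trans (ler_wpM2r (ltW N0) k3).
  by rewrite le_eqVlt; apply/orP; left; apply/eqP; field.
(* Here 3k/n - 1 >= 1/5. *)
have B1 : (A <= 15 * B)%R.
  rewrite -(ler_pM2l n0); have := ler_wpM2r A0 k0; nra.
have Q1 : (15 * e * B <= 6 * Q + 15 * D)%R.
  rewrite -(ler_pM2l n0); have := ler_wpM2r B0 nk; nra.
have D1 : (e * Q <= D)%R.
  rewrite -(ler_pM2l n0); have := ler_wpM2r Q0 nk; nra.
(* Multiplying [Q1] by e and using [D1] and e <= 1 gives 6 + 15 = 21. *)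
have D2 : (15 * e ^+ 2 * B <= 21 * D)%R.
  have := ler_wpM2l (ltW e0) Q1; have := ler_wpM2r D0 e1; rewrite expr2; nra.
rewrite -(ler_pM2r N0).
have e2A : (e ^+ 2 * (8 / 125 * n ^+ 6) <= 21 * D)%R.
  apply: le_trans D2; have /andP[e2_gt0 _] := e2.
  have := ler_wpM2l (ltW e2_gt0) (le_trans A1 B1).
  by rewrite [(15 * e ^+ 2)%R]mulrC -[(_ * 15 * B)%R]mulrA.
have := ler_wpM2l (ltW n0) e2A.
have := le_trans hn (ler_wpM2r (ltW N0) CE).
(* The constants give e^2 n <= 21 * 2592 * 125 / 8 = 850500. *)
move: (n ^+ 6)%R (e ^+ 2)%R N0 => N E N0; move: N0 D0; clear; nra.
Qed.

(** * The lower bound *)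

Definition bipyramid_adj (p q : nat) : bool :=
  (p != q) && ~~ ((2 < p) && (2 < q)).

Definition bipyramid_face (p q r : nat) : bool :=
  [&& bipyramid_adj p q, bipyramid_adj p r, bipyramid_adj q r
    & [|| 2 < p, 2 < q | 2 < r]].

(** The class of a vertex is its residue modulo 5, so every class has at least [n %/ 5] vertices. *)
Definition bipyramid_blowup (n : nat) : {set {set 'I_n}} :=
  [set e : {set 'I_n} | [&& #|e| == 3,
     [forall u in e, forall v in e,
        (u != v) ==> bipyramid_adj (u %% 5) (v %% 5)]
   & [exists u in e, 2 < u %% 5]]]%SET.

Lemma hedge_bipyramid_blowup (n : nat) (x y z : 'I_n) :
  hedge (bipyramid_blowup n) x y z = bipyramid_face (x %% 5) (y %% 5) (z %% 5).
Proof.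
have adjC p q : bipyramid_adj p q = bipyramid_adj q p.
  by rewrite /bipyramid_adj eq_sym [(2 < p) && _]andbC.
have adj_neq (u v : 'I_n) : bipyramid_adj (u %% 5) (v %% 5) -> u != v.
  by case/andP=> uv _; apply: contraNneq uv => ->.
rewrite /hedge inE; apply/idP/idP.
  case/and3P=> xyz3 /forall_inP adj /exists_inP[u uxyz u_pole].
  (* Seen as a 3-graph with a single edge, the triple has distinct vertices by [hedge_neq]. *)
  have H3 : is_3graph [set [set x; y; z]]%SET.
    by apply/forall_inP=> e; rewrite inE => /eqP->.
  have : hedge [set [set x; y; z]]%SET x y z by rewrite /hedge inE.
  move/(hedge_neq H3)=> /and3P[xy xz yz].
  have adjP v w : v \in [set x; y; z]%SET -> w \in [set x; y; z]%SET ->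
      v != w -> bipyramid_adj (v %% 5) (w %% 5).
    by move=> vin win; move/forall_inP: (adj v vin) => /(_ w win)/implyP.
  apply/and4P; split; try by apply: adjP => //; rewrite !inE eqxx ?orbT.
  by move: uxyz u_pole; rewrite !inE -orbA => /or3P[]/eqP-> ->; rewrite ?orbT.
case/and4P=> xy xz yz pole; apply/and3P; split.
- rewrite finset.setUC cardsU1 cards2 !inE (adj_neq _ _ xy).
  by rewrite ![z == _]eq_sym (negPf (adj_neq _ _ xz)) (negPf (adj_neq _ _ yz)).
- apply/forall_inP=> u; rewrite !inE -orbA => u_in.
  apply/forall_inP=> v; rewrite !inE -orbA => v_in; apply/implyP.
  by case/or3P: u_in => /eqP->; case/or3P: v_in => /eqP->;
    rewrite ?eqxx // adjC.
- by apply/exists_inP; case/or3P: pole => pole; [exists x|exists y|exists z];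
    rewrite // !inE eqxx ?orbT.
Qed.

Lemma bipyramid_blowup_is_3graph (n : nat) : is_3graph (bipyramid_blowup n).
Proof. by apply/forall_inP=> e; rewrite inE => /and3P[]. Qed.

Lemma bipyramid_F1_free (a b c d e f : nat) :
  a < 5 -> b < 5 -> c < 5 -> d < 5 -> e < 5 -> f < 5 ->
  bipyramid_face a b e -> bipyramid_face a c e -> bipyramid_face b c e ->
  bipyramid_face a b f -> bipyramid_face a d f -> bipyramid_face b d f ->
  ~~ bipyramid_adj c d.
Proof.
pose s := iota 0 5.
have in_s i : i < 5 -> i \in s by rewrite mem_iota.
move=> /in_s as_ /in_s bs /in_s cs /in_s ds /in_s es /in_s fs.
move=> abe ace bce abf adf bdf.
(* Finite check; the order a, b, e, f, c, d lets failed faces cut the enumeration early. *)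
have /allP/(_ a as_)/allP/(_ b bs)/allP/(_ e es) : all (fun a => all (fun b =>
    all (fun e => bipyramid_face a b e ==> all (fun f =>
    bipyramid_face a b f ==> all (fun c =>
    bipyramid_face a c e && bipyramid_face b c e ==> all (fun d =>
    bipyramid_face a d f && bipyramid_face b d f ==> ~~ bipyramid_adj c d)
    s) s) s) s) s) s by [].
rewrite abe => /allP/(_ f fs); rewrite abf => /allP/(_ c cs).
by rewrite ace bce => /allP/(_ d ds); rewrite adf bdf.
Qed.

Lemma bipyramid_blowup_F1_free (n : nat) : ~~ contains F1 (bipyramid_blowup n).
Proof.
apply/existsP=> -[f /andP[_ /forall_inP fF1]].
have edgeP (i j l : nat) : [set inord i; inord j; inord l]%SET \in F1 ->
    bipyramid_face (f (inord i) %% 5) (f (inord j) %% 5) (f (inord l) %% 5).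
  by move/fF1; rewrite !imsetU !imset_set1 => ?;
    rewrite -hedge_bipyramid_blowup.
have m5 m : m %% 5 < 5 by rewrite ltn_mod.
have := @bipyramid_F1_free _ _ _ _ _ _ (m5 (f (inord 0))) (m5 (f (inord 1)))
  (m5 (f (inord 2))) (m5 (f (inord 3))) (m5 (f (inord 4))) (m5 (f (inord 5))).
have /and4P[-> _ _ _] : bipyramid_face (f (inord 2) %% 5) (f (inord 3) %% 5)
    (f (inord 6) %% 5) by apply: edgeP; rewrite !inE eqxx ?orbT.
by move=> contra; suff: ~~ true by []; apply: contra;
  apply: edgeP; rewrite !inE eqxx ?orbT.
Qed.

Lemma bipyramid_adj_codeg (p q : nat) : p < 5 -> q < 5 -> bipyramid_adj p q ->
  exists r s, [/\ r < 5, s < 5, r != s, bipyramid_face p q r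
                & bipyramid_face p q s].
Proof.
move=> p5 q5 pq.
pose t := iota 0 5.
have in_t i : i < 5 -> i \in t by rewrite mem_iota.
have /allP/(_ p (in_t p p5))/allP/(_ q (in_t q q5)) :
    all (fun p => all (fun q => bipyramid_adj p q ==>
      has (fun r => has (fun s =>
        [&& r != s, bipyramid_face p q r & bipyramid_face p q s]) t) t) t) t.
  by [].
rewrite pq => /hasP[r]; rewrite mem_iota => r5 /hasP[s].
by rewrite mem_iota => s5 /and3P[]; exists r, s.
Qed.

Lemma bipyramid_blowup_pos_codeg (n : nat) :
  pos_codeg_ge (bipyramid_blowup n) (2 * (n %/ 5)).
Proof.
apply/forallP=> p; apply/implyP=> /andP[/cards2P[u [v [uv ->]]]].
case/exists_inP=> e; rewrite inE => /and3P[_ /forall_inP adj _].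
move=> /fintype.subsetP uve.
have {adj} adj : bipyramid_adj (u %% 5) (v %% 5).
  have ue : u \in e by apply: uve; rewrite !inE eqxx.
  have ve : v \in e by apply: uve; rewrite !inE eqxx orbT.
  by move/forall_inP: (adj u ue) => /(_ v ve)/implyP; apply.
have [r [s [r5 s5 rs uvr uvs]]] :=
  bipyramid_adj_codeg (ltn_pmod u (isT : 0 < 5)) (ltn_pmod v (isT : 0 < 5)) adj.
pose c (b : bool) := if b then r else s.
have c5 b : c b < 5 by case: b.
(* The [n %/ 5] complete blocks of five consecutive vertices each contain one vertex of either class
   [r], [s]. *)
have lt_n (x : bool * 'I_(n %/ 5)) : x.2 * 5 + c x.1 < n.
  have := ltn_ord x.2; have := c5 x.1; have := leq_trunc_div n 5; lia.
pose w x := Ordinal (lt_n x).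
have w_mod x : w x %% 5 = c x.1 by rewrite /= modnMDl modn_small.
have w_inj : injective w.
  move=> [b i] [b' i'] wE.
  have bb : b = b'.
    have := w_mod (b, i); rewrite wE w_mod /=.
    by case: (b) (b') => [] [] //= sr; rewrite sr eqxx in rs.
  rewrite bb in wE *; congr (_, _); apply/val_inj.
  by have /= := congr1 val wE; lia.
have w_edge x : hedge (bipyramid_blowup n) u v (w x).
  by rewrite hedge_bipyramid_blowup w_mod; case: (x.1).
have H3 := bipyramid_blowup_is_3graph n.
have f_inj : injective (fun x => [set u; v; w x]%SET).
  move=> x y /finset.setP/(_ (w x)); rewrite !inE eqxx orbT => /esym.
  have /and3P[_ uw vw] := hedge_neq H3 (w_edge x).
  by rewrite ![w x == _]eq_sym (negPf uw) (negPf vw) => /eqP/w_inj.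
have <- : #|{: bool * 'I_(n %/ 5)}| = 2 * (n %/ 5).
  by rewrite card_prod card_bool card_ord.
rewrite /codeg -(fintype.card_image f_inj).
apply/subset_leq_card/fintype.subsetP=> E.
case/mapP=> x _ ->; rewrite inE; apply/andP; split; first exact: w_edge.
exact: finset.subsetUl.
Qed.

Lemma coex_pos_F1_ge (n : nat) : 2 * n <= 5 * coex_pos n F1 + 8.
Proof.
suff: 2 * (n %/ 5) <= coex_pos n F1.
  have := divn_eq n 5; have := ltn_pmod n (isT : 0 < 5); lia.
have [n5|n5] := ltnP n 5; first by rewrite divn_small.
have H3 := bipyramid_blowup_is_3graph n.
have good : is_3graph (bipyramid_blowup n)
    && ~~ contains F1 (bipyramid_blowup n).
  by rewrite H3 bipyramid_blowup_F1_free.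
apply: (leq_trans _ (@leq_bigmax_cond _
  (fun H => is_3graph H && ~~ contains F1 H) _ _ good)).
rewrite /min_pos_codeg ifN; last first.
  (* Vertices 0, 1 and 3 form a face: two equator classes and a pole. *)
  apply/set0Pn; exists [set Ordinal (leq_trans (isT : 0 < 5) n5);
    Ordinal (leq_trans (isT : 1 < 5) n5);
    Ordinal (leq_trans (isT : 3 < 5) n5)]%SET.
  by rewrite -[_ \in _]/(hedge _ _ _ _) hedge_bipyramid_blowup.
have le_n : 2 * (n %/ 5) < #|'I_n|.+1.
  by rewrite card_ord; have := leq_trunc_div n 5; lia.
exact: (leq_bigmax_cond (Ordinal le_n) (bipyramid_blowup_pos_codeg n)).
Qed.

(** * The limit *)

Lemma coex_pos_F1_le (R : realType) (n : nat) (e : R) :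
  (0 < e <= 1)%R -> (1000 * 1000 < e ^+ 2 * n%:R)%R ->
  ((coex_pos n F1)%:R <= (2 / 5 + e) * n%:R)%R.
Proof.
move=> e01 n_large; rewrite leNgt; apply/negP=> lt_coex.
have e0 : (0 < e)%R by case/andP: e01.
have coex_gt0 : 0 < coex_pos n F1.
  rewrite -(ltr_nat R); apply: le_lt_trans lt_coex.
  by rewrite mulr_ge0 // addr_ge0 ?ltW // divr_gt0.
have [H /andP[H3 noF1] coexE] := bigmax_attained coex_gt0.
rewrite /coex_pos in coex_gt0 lt_coex; rewrite coexE in coex_gt0 lt_coex.
have := pos_codeg_F1_free H3 (min_pos_codeg_ge H) noF1
  (min_pos_codeg_edge H3 coex_gt0) e01.
by rewrite card_ord => /(_ (ltW lt_coex)); rewrite leNgt n_large.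
Qed.

Local Open Scope classical_set_scope.

Lemma coex_pos_ratio_F1_cvg (R : realType) :
  coex_pos_ratio R F1 @ \oo --> (2 / 5 : R)%R.
Proof.
apply/cvgrPdist_le => e e0.
(* The upper bound is available only for errors at most 1. *)
pose d : R := Num.min e 1%R.
have d01 : (0 < d <= 1)%R by rewrite lt_min e0 ltr01 ge_min lexx orbT.
have d0 : (0 < d)%R by case/andP: d01.
have de : (d <= e)%R by rewrite ge_min lexx.
near=> n.
have n_large : (1000 * 1000 < d ^+ 2 * n%:R)%R.
  rewrite [(d ^+ 2 * _)%R]mulrC -ltr_pdivrMr ?exprn_gt0 //.
  by near: n; apply: nbhs_infty_gtr.
(* The lower bound loses 8/(5n), which is below e since 8/5 < 2. *)
have n_large' : (2 / e < n%:R)%R by near: n; apply: nbhs_infty_gtr.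
have n0 : (0 < n%:R :> R)%R by apply: lt_trans n_large'; rewrite divr_gt0.
have upper := coex_pos_F1_le d01 n_large.
have lower : (2 * n%:R - 8 <= 5 * (coex_pos n F1)%:R :> R)%R.
  rewrite lerBlDr -!natrM -natrD ler_nat.
  by have := coex_pos_F1_ge n; rewrite addnC.
rewrite ler_norml /coex_pos_ratio; apply/andP; split.
  rewrite lerBrDr addrC lerBlDr ler_pdivrMr //; apply: le_trans upper _.
  by rewrite ler_wpM2r ?ler0n // lerD2l.
rewrite lerBlDr -lerBlDl ler_pdivlMr //.
rewrite ltr_pdivrMr // in n_large'.
by move: lower n_large'; nra.
Unshelve. all: by end_near. Qed.

Theorem theorem2p3 (R : realType) :
  cvgn (coex_pos_ratio R F1) /\ gamma_pos R F1 = (2 / 5)%R.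
Proof.
have cv := @coex_pos_ratio_F1_cvg R.
by split; [apply: cvgP cv | apply: cvg_lim cv].
Qed.
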